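(* The operad $\mathsf{C}\mathbb{D}_0^2$ is isomorphic to the suboperad of $\mathsf{DMT}$ consisting in the linear span of all double multi-tildes except the three nontrivial double multi-tildes of arity $1$ (i.e. those of arity $1$ other than $(1,\emptyset,\emptyset)$). Moreover, the linear map $\phi$ sending $(1,\emptyset,\emptyset)$ to the unit of $\mathsf{C}\mathbb{D}_0^2$ and any double multi-tilde $(n,\mathfrak{s},\mathfrak{t})$ of arity $n\ge2$ to the $\mathbb{D}_0^2$-clique of arity $n$ defined, for any $1\le x<y\le n+1$, by $$\phi((n,\mathfrak{s},\mathfrak{t}))(x,y):=\begin{cases}(0,\mathds{1})&\text{if }(x,y-1)\in\mathfrak{s}\text{ and }(x,y-1)\notin\mathfrak{t},\\(\mathds{1},0)&\text{if }(x,y-1)\notin\mathfrak{s}\text{ and }(x,y-1)\in\mathfrak{t},\\(0,0)&\text{if }(x,y-1)\in\mathfrak{s}\text{ and }(x,y-1)\in\mathfrak{t},\\(\mathds{1},\mathds{1})&\text{otherwise,}\end{cases}$$ is an isomorphism between these two operads.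
   Context: All vector spaces are over a field $\mathbb{K}$ of characteristic zero; $[n]=\{1,\dots,n\}$. Operad means nonsymmetric operad in vector spaces, graded by arities $n\ge1$. $\mathbb{D}_0=\{\mathds{1},0\}$ is the unitary magma with unit $\mathds{1}$ and absorbing element $0$ (so $0\star0=0$), and $\mathbb{D}_0^2=\mathbb{D}_0\times\mathbb{D}_0$ has the component-wise operation $\star$, with unit $(\mathds{1},\mathds{1})$. A $\mathbb{D}_0^2$-clique $\mathfrak{p}$ of arity $n\ge1$ is a map assigning to every arc $(x,y)$, $1\le x<y\le n+1$, a label $\mathfrak{p}(x,y)\in\mathbb{D}_0^2$; by convention, the only one of arity $1$ is the one with $\mathfrak{p}(1,2)=(\mathds{1},\mathds{1})$. Put $\mathfrak{p}_0:=\mathfrak{p}(1,n+1)$ and $\mathfrak{p}_i:=\mathfrak{p}(i,i+1)$ for $i\in[n]$. $\mathsf{C}\mathbb{D}_0^2$ is the operad whose space $\mathsf{C}\mathbb{D}_0^2(n)$ is the linear span of all $\mathbb{D}_0^2$-cliques of arity $n$, whose unit is the unique clique of arity $1$, and where, for $\mathfrak{p},\mathfrak{q}$ of arities $n,m$ and $i\in[n]$, $$(\mathfrak{p}\circ_i\mathfrak{q})(x,y)=\begin{cases}\mathfrak{p}(x,y)&\text{if }y\le i,\\ \mathfrak{p}(x,y-m+1)&\text{if }x\le i<i+m\le y,\ (x,y)\ne(i,i+m),\\ \mathfrak{p}(x-m+1,y-m+1)&\text{if }i+m\le x,\\ \mathfrak{q}(x-i+1,y-i+1)&\text{if }i\le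 x<y\le i+m,\ (x,y)\ne(i,i+m),\\ \mathfrak{p}_i\star\mathfrak{q}_0&\text{if }(x,y)=(i,i+m),\\ (\mathds{1},\mathds{1})&\text{otherwise.}\end{cases}$$ A multi-tilde of arity $n$ is a pair $(n,\mathfrak{s})$ with $n\ge1$ and $\mathfrak{s}\subseteq\{(x,y)\in[n]^2:x\le y\}$. For multi-tildes $(n,\mathfrak{s})$, $(m,\mathfrak{u})$ and $i\in[n]$, set $\mathfrak{s}\circ_i\mathfrak{u}:=\{\mathrm{sh}_{i,m}(x,y):(x,y)\in\mathfrak{s}\}\cup\{\mathrm{sh}_{0,i}(x,y):(x,y)\in\mathfrak{u}\}$, where $\mathrm{sh}_{j,p}(x,y):=(x,y)$ if $y\le j-1$; $(x,y+p-1)$ if $x\le j\le y$; and $(x+p-1,y+p-1)$ otherwise. (Thus $\mathrm{sh}_{0,i}(x,y)=(x+i-1,y+i-1)$.) A double multi-tilde of arity $n$ is a triple $(n,\mathfrak{s},\mathfrak{t})$ where $(n,\mathfrak{s})$ and $(n,\mathfrak{t})$ are multi-tildes. $\mathsf{DMT}$ is the operad where $\mathsf{DMT}(n)$ is the linear span of all double multi-tildes of arity $n$, with unit $(1,\emptyset,\emptyset)$ and partial composition $(n,\mathfrak{s},\mathfrak{t})\circ_i(m,\mathfrak{u},\mathfrak{v}):=(n+m-1,\ \mathfrak{s}\circ_i\mathfrak{u},\ \mathfrak{t}\circ_i\mathfrak{v})$ for $i\in[n]$. *)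

(* Defs.v *)
From HB Require Import structures.
From mathcomp Require Import all_boot all_order all_algebra.
From mathcomp Require Import zify.

Set Implicit Arguments.
Unset Strict Implicit.
Unset Printing Implicit Defensive.

Import GRing.Theory.
Local Open Scope ring_scope.

(** * Nonsymmetric operads in vector spaces *)

(* Operads are graded by the arities >= 1: the component of index [n] is the  *)
(* space of the elements of arity [n.+1], so that composing arities [n.+1]    *)
(* and [m.+1] gives index [n + m].  Positions are numbered from 1, and        *)
(* [comp i x y] is meaningful only if [1 <= i <= arity of x]; its other       *)
(* values are unconstrained.  [Tagged] is used to equate elements whose       *)
(* arities are equal but not convertible.                                     *)
Record operad (K : fieldType) := Operad {
  op_space :> nat -> lmodType K;
  op_unit : op_space 0;
  op_comp : forall n m : nat, nat -> op_space n -> op_space m -> op_space (n + m)%N;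
  op_linl : forall (n m i : nat) (y : op_space m), (0 < i <= n.+1)%N ->
    linear (fun x : op_space n => op_comp i x y);
  op_linr : forall (n m i : nat) (x : op_space n), (0 < i <= n.+1)%N ->
    linear (fun y : op_space m => op_comp i x y);
  op_unitl : forall (n : nat) (x : op_space n), op_comp 1 op_unit x = x;
  op_unitr : forall (n i : nat) (x : op_space n), (0 < i <= n.+1)%N ->
    Tagged op_space (op_comp i x op_unit) = Tagged op_space x;
  op_assoc : forall (n m k i j : nat)
      (x : op_space n) (y : op_space m) (z : op_space k),
    (0 < i <= n.+1)%N -> (0 < j <= m.+1)%N ->
    Tagged op_space (op_comp (i + j - 1)%N (op_comp i x y) z) =
    Tagged op_space (op_comp i x (op_comp j y z));
  op_comm : forall (n m k i j : nat)
      (x : op_space n) (y : op_space m) (z : op_space k),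
    (0 < i < j)%N -> (j <= n.+1)%N ->
    Tagged op_space (op_comp (j + m)%N (op_comp i x y) z) =
    Tagged op_space (op_comp i (op_comp j x z) y)
}.

Definition is_operad_morphism (K : fieldType) (O P : operad K)
    (f : forall n, O n -> P n) : Prop :=
  [/\ forall n, linear (f n),
      f 0 (op_unit O) = op_unit P &
      forall (n m i : nat) (x : O n) (y : O m), (0 < i <= n.+1)%N ->
        f (n + m)%N (op_comp i x y) = op_comp i (f n x) (f m y)].

Definition is_operad_isomorphism (K : fieldType) (O P : operad K)
    (f : forall n, O n -> P n) : Prop :=
  is_operad_morphism f /\ forall n, bijective (f n).

Definition operad_isomorphic (K : fieldType) (O P : operad K) : Prop :=
  exists f : forall n, O n -> P n, is_operad_isomorphism f.

(** * Suboperads *)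

Record is_suboperad (K : fieldType) (O : operad K) (S : forall n, {pred O n}) :
    Prop := IsSuboperad {
  subop_submod : forall n, submod_closed (S n);
  subop_unit : op_unit O \in S 0;
  subop_comp : forall (n m i : nat) (x : O n) (y : O m), (0 < i <= n.+1)%N ->
    x \in S n -> y \in S m -> op_comp i x y \in S (n + m)%N
}.

Section Suboperad.
Variables (K : fieldType) (O : operad K) (S : forall n, {pred O n}).
Hypothesis S_subop : is_suboperad S.

(* An alias of [S] that carries the proof needed by the instances below.      *)
Definition subop_pred (_ : is_suboperad (@S)) (n : nat) : {pred O n} := @S n.
Arguments subop_pred : clear implicits.
Local Notation SP := (subop_pred S_subop).

HB.instance Definition _ n :=
  GRing.isSubmodClosed.Build K (O n) (SP n) (subop_submod S_subop n).

Record subop_space n := SubopSpace {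
  subop_val : O n;
  _ : subop_val \in SP n
}.

HB.instance Definition _ n := [isSub of subop_space n for @subop_val n].
HB.instance Definition _ n := [Choice of subop_space n by <:].
HB.instance Definition _ n := [SubChoice_isSubLmodule of subop_space n by <:].

Definition subop_unit_elt : subop_space 0 := SubopSpace (subop_unit S_subop).

(* For a meaningful [i] the composite is in the subspace; [insubd] sends the  *)
(* other values that may fall outside of it to 0.                             *)
Definition subop_comp_elt n m i (x : subop_space n) (y : subop_space m) :
    subop_space (n + m) :=
  insubd (0 : subop_space (n + m)) (op_comp i (\val x) (\val y)).

Lemma val_subop_comp_elt n m i (x : subop_space n) (y : subop_space m) :
  (0 < i <= n.+1)%N ->
  \val (subop_comp_elt i x y) = op_comp i (\val x) (\val y).
Proof.
move=> hi; rewrite /subop_comp_elt val_insubd.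
by rewrite (subop_comp S_subop hi (valP x) (valP y)).
Qed.

Lemma Tagged_subop_inj n m (x : subop_space n) (y : subop_space m) :
  Tagged (fun n => O n) (\val x) = Tagged (fun n => O n) (\val y) ->
  Tagged subop_space x = Tagged subop_space y.
Proof.
move=> E; have e : n = m := congr1 (@tag _ _) E.
case: _ / e y E => y E; congr existT; apply: val_inj; exact: eq_from_Tagged E.
Qed.

Lemma val_subop_lin n (a : K) (u v : subop_space n) :
  \val (a *: u + v) = a *: \val u + \val v.
Proof. by rewrite GRing.valD GRing.valZ. Qed.

Fact subop_linl n m i (y : subop_space m) : (0 < i <= n.+1)%N ->
  linear (fun x : subop_space n => subop_comp_elt i x y).
Proof.
move=> hi a u v; apply: val_inj.
rewrite val_subop_lin !val_subop_comp_elt // val_subop_lin.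
exact: (op_linl _ hi).
Qed.

Fact subop_linr n m i (x : subop_space n) : (0 < i <= n.+1)%N ->
  linear (fun y : subop_space m => subop_comp_elt i x y).
Proof.
move=> hi a u v; apply: val_inj.
rewrite val_subop_lin !val_subop_comp_elt // val_subop_lin.
exact: (op_linr _ hi).
Qed.

Fact subop_unitl n (x : subop_space n) : subop_comp_elt 1 subop_unit_elt x = x.
Proof. by apply: val_inj; rewrite val_subop_comp_elt //; apply: op_unitl. Qed.

Fact subop_unitr n i (x : subop_space n) : (0 < i <= n.+1)%N ->
  Tagged subop_space (subop_comp_elt i x subop_unit_elt) = Tagged subop_space x.
Proof.
move=> hi; apply: Tagged_subop_inj; rewrite val_subop_comp_elt //.
exact: op_unitr.
Qed.

Fact subop_assoc n m k i j
    (x : subop_space n) (y : subop_space m) (z : subop_space k) :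
  (0 < i <= n.+1)%N -> (0 < j <= m.+1)%N ->
  Tagged subop_space (subop_comp_elt (i + j - 1)%N (subop_comp_elt i x y) z) =
  Tagged subop_space (subop_comp_elt i x (subop_comp_elt j y z)).
Proof.
move=> hi hj; apply: Tagged_subop_inj.
rewrite !val_subop_comp_elt //; last by lia.
exact: op_assoc.
Qed.

Fact subop_comm n m k i j
    (x : subop_space n) (y : subop_space m) (z : subop_space k) :
  (0 < i < j)%N -> (j <= n.+1)%N ->
  Tagged subop_space (subop_comp_elt (j + m)%N (subop_comp_elt i x y) z) =
  Tagged subop_space (subop_comp_elt i (subop_comp_elt j x z) y).
Proof.
move=> hi hj; apply: Tagged_subop_inj.
rewrite !val_subop_comp_elt //; try lia.
exact: op_comm.
Qed.

Definition sub_operad : operad K :=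
  Operad subop_linl subop_linr subop_unitl subop_unitr subop_assoc subop_comm.

End Suboperad.

(** * Linearization of set-theoretic operads *)

Record set_operad := SetOperad {
  sop_set :> nat -> finType;
  sop_unit : sop_set 0;
  sop_comp : forall n m : nat, nat -> sop_set n -> sop_set m -> sop_set (n + m)%N;
  sop_unitl : forall (n : nat) (x : sop_set n), sop_comp 1 sop_unit x = x;
  sop_unitr : forall (n i : nat) (x : sop_set n), (0 < i <= n.+1)%N ->
    Tagged sop_set (sop_comp i x sop_unit) = Tagged sop_set x;
  sop_assoc : forall (n m k i j : nat)
      (x : sop_set n) (y : sop_set m) (z : sop_set k),
    (0 < i <= n.+1)%N -> (0 < j <= m.+1)%N ->
    Tagged sop_set (sop_comp (i + j - 1)%N (sop_comp i x y) z) =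
    Tagged sop_set (sop_comp i x (sop_comp j y z));
  sop_comm : forall (n m k i j : nat)
      (x : sop_set n) (y : sop_set m) (z : sop_set k),
    (0 < i < j)%N -> (j <= n.+1)%N ->
    Tagged sop_set (sop_comp (j + m)%N (sop_comp i x y) z) =
    Tagged sop_set (sop_comp i (sop_comp j x z) y)
}.

(* The vector space with basis [T]. *)
Definition freevs (K : fieldType) (T : finType) : vectType K := {ffun T -> K^o}.

Definition basis_vec (K : fieldType) (T : finType) (t : T) : freevs K T :=
  [ffun u => (u == t)%:R].

Definition lin_ext (K : fieldType) (T U : finType) (f : T -> U)
    (x : freevs K T) : freevs K U :=
  \sum_(t : T) (x t : K) *: basis_vec K (f t).

Section Linearization.
Variables (K : fieldType) (P : set_operad).

Definition lop_comp n m i (x : freevs K (P n)) (y : freevs K (P m)) :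
    freevs K (P (n + m)%N) :=
  \sum_(p : P n) \sum_(q : P m)
    ((x p : K) * (y q : K)) *: basis_vec K (sop_comp i p q).

Fact lop_linl n m i (y : freevs K (P m)) : (0 < i <= n.+1)%N ->
  linear (fun x : freevs K (P n) => lop_comp i x y).
Proof.
move=> _ a u v; rewrite /lop_comp scaler_sumr -big_split /=.
apply: eq_bigr => p _; rewrite scaler_sumr -big_split /=.
by apply: eq_bigr => q _; rewrite !ffunE mulrDl scalerDl scalerA mulrA.
Qed.

Fact lop_linr n m i (x : freevs K (P n)) : (0 < i <= n.+1)%N ->
  linear (fun y : freevs K (P m) => lop_comp i x y).
Proof.
move=> _ a u v; rewrite /lop_comp scaler_sumr -big_split /=.
apply: eq_bigr => p _; rewrite scaler_sumr -big_split /=.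
apply: eq_bigr => q _; rewrite !ffunE mulrDr scalerDl scalerA.
by rewrite mulrCA.
Qed.

Lemma freevsE (T : finType) (x : freevs K T) :
  x = \sum_(t : T) (x t : K) *: basis_vec K t.
Proof.
apply/ffunP => u; rewrite sum_ffunE (bigD1 u) //= !ffunE eqxx.
rewrite big1 ?addr0 => [|t /negPf tu]; first by rewrite /GRing.scale /= mulr1.
by rewrite !ffunE eq_sym tu /GRing.scale /= mulr0.
Qed.

Lemma sum_basis (T : finType) (V : lmodType K) (F : T -> V) (p : T) :
  \sum_(t : T) (basis_vec K p t : K) *: F t = F p.
Proof.
rewrite (bigD1 p) //= ffunE eqxx scale1r big1 ?addr0 // => t /negPf tp.
by rewrite ffunE tp scale0r.
Qed.

Lemma sum_coord (T S : finType) (V : lmodType K) (f : S -> K) (a : S -> T)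
    (G : T -> V) :
  \sum_t ((\sum_s f s *: basis_vec K (a s) : freevs K T) t : K) *: G t =
  \sum_s f s *: G (a s).
Proof.
transitivity (\sum_t \sum_s (f s * (basis_vec K (a s) t : K)) *: G t).
  apply: eq_bigr => t _; rewrite -scaler_suml; congr (_ *: _).
  by rewrite sum_ffunE; apply: eq_bigr => s _; rewrite ffunE.
rewrite exchange_big /=; apply: eq_bigr => s _.
under eq_bigr => t _ do rewrite -scalerA.
by rewrite -scaler_sumr sum_basis.
Qed.

Lemma lop_comp_sum n m i (T U : finType) (f : T -> K) (g : U -> K)
    (a : T -> P n) (b : U -> P m) :
  lop_comp i (\sum_t f t *: basis_vec K (a t)) (\sum_u g u *: basis_vec K (b u))
  = \sum_t \sum_u (f t * g u) *: basis_vec K (sop_comp i (a t) (b u)).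
Proof.
rewrite /lop_comp.
under eq_bigr => p _.
  under eq_bigr => q _ do rewrite -scalerA.
  rewrite -scaler_sumr sum_coord; over.
rewrite sum_coord; apply: eq_bigr => t _; rewrite scaler_sumr.
by apply: eq_bigr => u _; rewrite scalerA.
Qed.

Lemma Tagged_sum (T : finType) (f : T -> K) n m (a : T -> P n) (b : T -> P m) :
  n = m -> (forall t, Tagged (fun n => P n) (a t) = Tagged (fun n => P n) (b t)) ->
  Tagged (fun n => freevs K (P n)) (\sum_t f t *: basis_vec K (a t)) =
  Tagged (fun n => freevs K (P n)) (\sum_t f t *: basis_vec K (b t)).
Proof.
move=> e; case: _ / e b => b ab; congr existT; apply: eq_bigr => t _.
by rewrite (eq_from_Tagged (ab t)).
Qed.

Lemma lop_compE n m i (x : freevs K (P n)) (y : freevs K (P m)) :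
  lop_comp i x y = \sum_(t : P n * P m) ((x t.1 : K) * (y t.2 : K)) *:
                     basis_vec K (sop_comp i t.1 t.2).
Proof. by rewrite /lop_comp pair_bigA. Qed.

Fact lop_unitl n (x : freevs K (P n)) :
  lop_comp 1 (basis_vec K (sop_unit P)) x = x.
Proof.
rewrite /lop_comp [RHS]freevsE exchange_big /=; apply: eq_bigr => q _.
under eq_bigr => p _ do rewrite -scalerA.
by rewrite sum_basis sop_unitl.
Qed.

Fact lop_unitr n i (x : freevs K (P n)) : (0 < i <= n.+1)%N ->
  Tagged (fun n => freevs K (P n)) (lop_comp i x (basis_vec K (sop_unit P))) =
  Tagged (fun n => freevs K (P n)) x.
Proof.
move=> hi; rewrite [in RHS](freevsE x).
have -> : lop_comp i x (basis_vec K (sop_unit P)) =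
    \sum_p (x p : K) *: basis_vec K (sop_comp i p (sop_unit P)).
  apply: eq_bigr => p _.
  by under eq_bigr => q _ do rewrite mulrC -scalerA; rewrite sum_basis.
by apply: Tagged_sum => [|t]; [rewrite addn0 | apply: sop_unitr].
Qed.

Fact lop_assoc n m k i j
    (x : freevs K (P n)) (y : freevs K (P m)) (z : freevs K (P k)) :
  (0 < i <= n.+1)%N -> (0 < j <= m.+1)%N ->
  Tagged (fun n => freevs K (P n)) (lop_comp (i + j - 1)%N (lop_comp i x y) z) =
  Tagged (fun n => freevs K (P n)) (lop_comp i x (lop_comp j y z)).
Proof.
move=> hi hj; rewrite [lop_comp i x y]lop_compE [in LHS](freevsE z) lop_comp_sum pair_bigA /=.
rewrite [lop_comp j y z]lop_compE [in RHS](freevsE x) lop_comp_sum /=.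
under [in RHS]eq_bigr do under eq_bigr do rewrite mulrA.
rewrite pair_bigA /=.
pose h (t : P n * (P m * P k)) : (P n * P m) * P k := ((t.1, t.2.1), t.2.2).
have bij_h : bijective h.
  by exists (fun t => (t.1.1, (t.1.2, t.2))) => [[? []]|[[]]].
rewrite (reindex h) /=; last exact: onW_bij.
by apply: Tagged_sum => [|t]; [rewrite addnA | apply: sop_assoc].
Qed.

Fact lop_comm n m k i j
    (x : freevs K (P n)) (y : freevs K (P m)) (z : freevs K (P k)) :
  (0 < i < j)%N -> (j <= n.+1)%N ->
  Tagged (fun n => freevs K (P n)) (lop_comp (j + m)%N (lop_comp i x y) z) =
  Tagged (fun n => freevs K (P n)) (lop_comp i (lop_comp j x z) y).
Proof.
move=> hi hj; rewrite [lop_comp i x y]lop_compE [in LHS](freevsE z) lop_comp_sum pair_bigA /=.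
rewrite [lop_comp j x z]lop_compE [in RHS](freevsE y) lop_comp_sum pair_bigA /=.
pose h (t : (P n * P k) * P m) : (P n * P m) * P k := ((t.1.1, t.2), t.1.2).
have bij_h : bijective h.
  by exists (fun t => ((t.1.1, t.2), t.1.2)) => [[[]]|[[]]].
rewrite (reindex h) /=; last exact: onW_bij.
under eq_bigr do rewrite mulrAC.
by apply: Tagged_sum => [|t]; [rewrite addnAC | apply: sop_comm].
Qed.

Definition lin_operad : operad K :=
  Operad lop_linl lop_linr lop_unitl lop_unitr lop_assoc lop_comm.

End Linearization.

Local Open Scope nat_scope.

(** * The operad of D_0^2-cliques *)

(* [true] is the unit and [false] the absorbing element.                      *)
Definition D0 : finType := bool.
Definition D0_one : D0 := true.
Definition D0_zero : D0 := false.
Definition D0_mul (a b : D0) : D0 := a && b.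

Definition D02 : finType := (D0 * D0)%type.
Definition D02_one : D02 := (D0_one, D0_one).
Definition D02_mul (a b : D02) : D02 := (D0_mul a.1 b.1, D0_mul a.2 b.2).

(* Arcs (x, y) with 1 <= x < y <= n + 1.                                      *)
Definition arc (n : nat) : finType :=
  {a : 'I_n.+2 * 'I_n.+2 | 0 < a.1 < a.2}.
Definition arc_ends n (a : arc n) : nat * nat := ((val a).1 : nat, (val a).2 : nat).

(* A clique of arity n; the only one of arity 1 has the unit label.           *)
Definition clique (n : nat) : finType :=
  {p : {ffun arc n -> D02} | (n == 1) ==> [forall a, p a == D02_one]}.

(* The label p(x, y), extended by the unit when (x, y) is not an arc.         *)
Definition label n (p : clique n) (x y : nat) : D02 :=
  if [pick a : arc n | arc_ends a == (x, y)] is Some a then val p a else D02_one.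

Definition clique_labels n (f : nat -> nat -> D02) : {ffun arc n -> D02} :=
  [ffun a => if n == 1 then D02_one else f (arc_ends a).1 (arc_ends a).2].

Fact clique_labelsP n f : (n == 1) ==> [forall a, clique_labels n f a == D02_one].
Proof.
by apply/implyP => n1; apply/forallP => a; rewrite ffunE n1.
Qed.

(* The clique of arity n with labels f(x, y).  In arity 1, there is only one  *)
(* clique, and f is ignored.                                                  *)
Definition mk_clique n (f : nat -> nat -> D02) : clique n :=
  Sub (clique_labels n f) (clique_labelsP n f).

Definition clique_unit : clique 1 := mk_clique 1 (fun _ _ => D02_one).

(* The labels of the i-th partial composition of the cliques with labels [p]  *)
(* and [q], where m is the arity of the second one, for labels in a magma     *)
(* with operation [star] and unit [one].                                      *)
Definition comp_label (A : Type) (star : A -> A -> A) (one : A) (m i : nat)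
    (p q : nat -> nat -> A) (x y : nat) : A :=
  if y <= i then p x y
  else if [&& x <= i, i + m <= y & (x, y) != (i, i + m)] then p x (y - m + 1)
  else if i + m <= x then p (x - m + 1) (y - m + 1)
  else if [&& i <= x, x < y, y <= i + m & (x, y) != (i, i + m)] then
    q (x - i + 1) (y - i + 1)
  else if (x, y) == (i, i + m) then star (p i (i + 1)) (q 1 (m + 1))
  else one.

Definition clique_comp n m i (p : clique n.+1) (q : clique m.+1) :
    clique (n + m).+1 :=
  mk_clique (n + m).+1 (comp_label D02_mul D02_one m.+1 i (label p) (label q)).

Lemma D02_mulA : associative D02_mul.
Proof. by do 3![case=> [[] []]]. Qed.

Lemma D02_mul1x : left_id D02_one D02_mul.
Proof. by case=> [[] []]. Qed.

Lemma D02_mulx1 : right_id D02_one D02_mul.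
Proof. by case=> [[] []]. Qed.

Lemma label_mk n f x y : 0 < x < y -> y <= n.+1 ->
  label (mk_clique n f) x y = if n == 1 then D02_one else f x y.
Proof.
move=> hxy hy; rewrite /label; case: pickP => [a /eqP e | no].
  by rewrite /= ffunE e.
have hx2 : x < n.+2 by lia.
have hy2 : y < n.+2 by lia.
have ha : 0 < (Ordinal hx2, Ordinal hy2).1 < (Ordinal hx2, Ordinal hy2).2 by [].
by have := no (exist _ (Ordinal hx2, Ordinal hy2) ha); rewrite /arc_ends /= eqxx.
Qed.

Lemma label1 (p : clique 1) x y : label p x y = D02_one.
Proof.
rewrite /label; case: pickP => // a _; apply/eqP.
by have /forallP := implyP (valP p) isT.
Qed.

Lemma arc_endsP n (a : arc n) :
  0 < (arc_ends a).1 < (arc_ends a).2 /\ (arc_ends a).2 <= n.+1.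
Proof. by split; [exact: (valP a) | rewrite -ltnS; exact: ltn_ord]. Qed.

Lemma arc_ends_inj n : injective (@arc_ends n).
Proof.
case=> [[a1 a2] pa] [[b1 b2] pb] [/= e1 e2]; apply: val_inj => /=.
by congr pair; apply: val_inj.
Qed.

Lemma label_val n (p : clique n) (a : arc n) :
  label p (arc_ends a).1 (arc_ends a).2 = val p a.
Proof.
rewrite /label; case: pickP => [b /eqP e | /(_ a)]; last by rewrite -surjective_pairing eqxx.
by congr (val p _); apply: arc_ends_inj; rewrite e -surjective_pairing.
Qed.

Lemma clique_eqP n m (p : clique n.+1) (q : clique m.+1) : n = m ->
  (forall x y, 0 < x < y -> y <= n.+2 -> label p x y = label q x y) ->
  Tagged (fun n => clique n.+1) p = Tagged (fun n => clique n.+1) q.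
Proof.
move=> e; case: _ / e q => q pq; congr existT.
apply: val_inj; apply/ffunP => a; rewrite -!label_val.
by have [? ?] := arc_endsP a; apply: pq.
Qed.

Lemma label_comp n m i (p : clique n.+1) (q : clique m.+1) x y :
  0 < i <= n.+1 -> 0 < x < y -> y <= (n + m).+2 ->
  label (clique_comp i p q) x y =
    comp_label D02_mul D02_one m.+1 i (label p) (label q) x y.
Proof.
move=> hi hxy hy; rewrite label_mk //; case: eqP => // - [/eqP].
rewrite addn_eq0 => /andP[/eqP n0 /eqP m0]; subst n m.
rewrite /comp_label !label1; do !case: ifP => //.
Qed.

Section CompLabel.
Variables (A : Type) (star : A -> A -> A) (one : A).

Lemma comp_label_ext n m i (p p' q q' : nat -> nat -> A) x y :
  0 < i <= n.+1 -> 0 < x < y -> y <= (n + m).+2 ->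
  (forall x y, 0 < x < y -> y <= n.+2 -> p x y = p' x y) ->
  (forall x y, 0 < x < y -> y <= m.+2 -> q x y = q' x y) ->
  comp_label star one m.+1 i p q x y = comp_label star one m.+1 i p' q' x y.
Proof.
move=> hi hxy hy hp hq; rewrite /comp_label !xpair_eqE.
case: ifP => h1; first by apply: hp; lia.
case: ifP => h2; first by apply: hp; lia.
case: ifP => h3; first by apply: hp; lia.
case: ifP => h4; first by apply: hq; lia.
by case: ifP => // h5; rewrite hp ?hq //; lia.
Qed.

Variant comp_label_spec (m i : nat) (p q : nat -> nat -> A) (x y : nat) :
    A -> Type :=
  | CompLeft of y <= i : comp_label_spec m i p q x y (p x y)
  | CompOver of x <= i & i + m <= y & x < i \/ i + m < y :
      comp_label_spec m i p q x y (p x (y - m + 1))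
  | CompRight of i + m <= x :
      comp_label_spec m i p q x y (p (x - m + 1) (y - m + 1))
  | CompIn of i <= x & y <= i + m & i < x \/ y < i + m :
      comp_label_spec m i p q x y (q (x - i + 1) (y - i + 1))
  | CompGlue of x = i & y = i + m :
      comp_label_spec m i p q x y (star (p i (i + 1)) (q 1 (m + 1)))
  | CompCross of x < i /\ i < y < i + m \/ i < x < i + m /\ i + m < y :
      comp_label_spec m i p q x y one.

Lemma comp_labelP m i p q x y : 0 < m -> x < y ->
  comp_label_spec m i p q x y (comp_label star one m i p q x y).
Proof.
move=> hm hxy; rewrite /comp_label !xpair_eqE.
case: ifP => h1; first by constructor; lia.
case: ifP => h2; first by constructor; lia.
case: ifP => h3; first by constructor; lia.
case: ifP => h4; first by constructor; lia.
by case: ifP => h5; constructor; lia.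
Qed.

Hypothesis starA : associative star.

Lemma comp_label_assoc n m k i j (p q r : nat -> nat -> A) x y :
  0 < i <= n.+1 -> 0 < j <= m.+1 -> 0 < x < y -> y <= (n + m + k).+2 ->
  comp_label star one k.+1 (i + j - 1) (comp_label star one m.+1 i p q) r x y =
  comp_label star one (m + k).+1 i p (comp_label star one k.+1 j q r) x y.
Proof.
move=> /andP[hi _] /andP[hj hjm] /andP[_ hxy] _.
case: (@comp_labelP k.+1) => // *;
  (case: (@comp_labelP (m + k).+1) => // *; first [exfalso; lia | idtac]);
  repeat (case: comp_labelP => *; [lia | lia | (exfalso; lia) || idtac ..]) => //.
all: try by rewrite -starA; congr (star _ (star (q _ _) _)); lia.
all: try by congr (star (q _ _) _); lia.
all: try by congr (star _ (q _ _)); lia.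
all: by (congr p + congr q + congr r); lia.
Qed.

Lemma comp_label_comm n m k i j (p q r : nat -> nat -> A) x y :
  0 < i < j -> j <= n.+1 -> 0 < x < y -> y <= (n + m + k).+2 ->
  comp_label star one k.+1 (j + m) (comp_label star one m.+1 i p q) r x y =
  comp_label star one m.+1 i (comp_label star one k.+1 j p r) q x y.
Proof.
move=> /andP[hi hij] _ /andP[_ hxy] _.
case: (@comp_labelP k.+1) => // *;
  (case: (@comp_labelP m.+1 i (comp_label _ _ _ _ _ _)) => // *; first [exfalso; lia | idtac]);
  repeat (case: comp_labelP => *; [lia | lia | (exfalso; lia) || idtac ..]) => //.
all: try by congr (star (p _ _) _); lia.
all: by (congr p + congr q + congr r); lia.
Qed.

End CompLabel.

Fact clique_unitl n (p : clique n.+1) : clique_comp 1 clique_unit p = p.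
Proof.
have := @clique_eqP (0 + n) n (clique_comp 1 clique_unit p) p erefl.
move=> E; apply: (@eq_from_Tagged _ (fun n => clique n.+1) n); apply: E => x y hxy hy.
rewrite label_comp // /comp_label !label1 D02_mul1x !xpair_eqE.
case: ifP => h1; first by lia.
case: ifP => h2; first by lia.
case: ifP => h3; first by lia.
case: ifP => h4; first by congr (label p); lia.
case: ifP => h5; last by lia.
by congr (label p); lia.
Qed.

Fact clique_unitr n i (p : clique n.+1) : 0 < i <= n.+1 ->
  Tagged (fun n => clique n.+1) (clique_comp i p clique_unit) =
  Tagged (fun n => clique n.+1) p.
Proof.
move=> hi; apply: clique_eqP => [|x y hxy hy]; first by rewrite addn0.
rewrite label_comp // /comp_label !label1 D02_mulx1 !xpair_eqE.
case: ifP => // h1.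
case: ifP => h2; first by congr (label p); lia.
case: ifP => h3; first by congr (label p); lia.
case: ifP => h4; first by lia.
case: ifP => h5; last by lia.
by congr (label p); lia.
Qed.

Fact clique_assoc n m k i j
    (p : clique n.+1) (q : clique m.+1) (r : clique k.+1) :
  0 < i <= n.+1 -> 0 < j <= m.+1 ->
  Tagged (fun n => clique n.+1) (clique_comp (i + j - 1) (clique_comp i p q) r) =
  Tagged (fun n => clique n.+1) (clique_comp i p (clique_comp j q r)).
Proof.
move=> hi hj; apply: clique_eqP => [|x y hxy hy]; first by rewrite addnA.
rewrite !label_comp //; try lia.
rewrite (@comp_label_ext _ _ _ (n + m) k _ _
  (comp_label D02_mul D02_one m.+1 i (label p) (label q)) _ (label r)) //; try lia; last first.
  by move=> *; apply: label_comp.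
rewrite (@comp_label_ext _ _ _ n (m + k) _ _ (label p) _
  (comp_label D02_mul D02_one k.+1 j (label q) (label r))) //; try lia; last first.
  by move=> *; apply: label_comp.
by apply: (@comp_label_assoc _ _ _ D02_mulA n).
Qed.

Fact clique_commute n m k i j
    (p : clique n.+1) (q : clique m.+1) (r : clique k.+1) :
  0 < i < j -> j <= n.+1 ->
  Tagged (fun n => clique n.+1) (clique_comp (j + m) (clique_comp i p q) r) =
  Tagged (fun n => clique n.+1) (clique_comp i (clique_comp j p r) q).
Proof.
move=> hi hj; apply: clique_eqP => [|x y hxy hy]; first by rewrite addnAC.
rewrite !label_comp //; try lia.
rewrite (@comp_label_ext _ _ _ (n + m) k _ _
  (comp_label D02_mul D02_one m.+1 i (label p) (label q)) _ (label r)) //; try lia; last first.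
  by move=> *; apply: label_comp => //; lia.
rewrite (@comp_label_ext _ _ _ (n + k) m _ _
  (comp_label D02_mul D02_one k.+1 j (label p) (label r)) _ (label q)) //; try lia; last first.
  by move=> *; apply: label_comp => //; lia.
by apply: (@comp_label_comm _ _ _ n).
Qed.

Definition clique_set_operad : set_operad :=
  @SetOperad (fun n => clique n.+1) clique_unit clique_comp
    clique_unitl clique_unitr clique_assoc clique_commute.

Definition CD02 (K : fieldType) : operad K := lin_operad K clique_set_operad.

(** * The operad of double multi-tildes *)

(* Pairs (x, y) with 1 <= x <= y <= n.                                        *)
Definition cell (n : nat) : finType :=
  {c : 'I_n.+1 * 'I_n.+1 | 0 < c.1 <= c.2}.
Definition cell_pos n (c : cell n) : nat * nat := ((val c).1 : nat, (val c).2 : nat).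

Definition multitilde (n : nat) : finType := {set cell n}.

Definition mt_pairs n (s : multitilde n) : seq (nat * nat) :=
  [seq cell_pos c | c in s].

Definition sh (j p : nat) (c : nat * nat) : nat * nat :=
  let: (x, y) := c in
  if y < j then (x, y)
  else if x <= j <= y then (x, y + p - 1)
  else (x + p - 1, y + p - 1).

(* For 1 <= i <= n + 1, all the shifted pairs are cells of arity n + m + 1.   *)
Definition mt_comp n m i (s : multitilde n.+1) (u : multitilde m.+1) :
    multitilde (n + m).+1 :=
  [set c | (cell_pos c \in [seq sh i m.+1 a | a <- mt_pairs s]) ||
           (cell_pos c \in [seq sh 0 i a | a <- mt_pairs u])].

Definition dmt (n : nat) : finType := (multitilde n * multitilde n)%type.

Definition dmt_unit : dmt 1 := (set0, set0).

Definition dmt_comp n m i (d : dmt n.+1) (e : dmt m.+1) : dmt (n + m).+1 :=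
  (mt_comp i d.1 e.1, mt_comp i d.2 e.2).

Lemma mt_pairsP n (s : multitilde n) a :
  a \in mt_pairs s -> 0 < a.1 <= a.2 /\ a.2 <= n.
Proof.
case/imageP => c _ ->; split; first exact: (valP c).
by rewrite -ltnS; apply: ltn_ord.
Qed.

Lemma cell_pos_inj n : injective (@cell_pos n).
Proof.
case=> [[a1 a2] pa] [[b1 b2] pb] [/= e1 e2]; apply: val_inj => /=.
by congr pair; apply: val_inj.
Qed.

Lemma mt_cell n x y : 0 < x <= y -> y <= n ->
  exists c : cell n, cell_pos c = (x, y).
Proof.
move=> hxy hy; have hx2 : x < n.+1 by lia.
have hy2 : y < n.+1 by lia.
have hc : 0 < (Ordinal hx2, Ordinal hy2).1 <= (Ordinal hx2, Ordinal hy2).2 by [].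
by exists (exist _ (Ordinal hx2, Ordinal hy2) hc).
Qed.

Lemma mem_mt_pairs n (s : multitilde n) c :
  (cell_pos c \in mt_pairs s) = (c \in s).
Proof. by rewrite mem_image //; apply: cell_pos_inj. Qed.

(* The arc (x, y) of a clique corresponds to the pair (x, y - 1).             *)
Definition mt_label n (s : multitilde n) (x y : nat) : bool :=
  (x, y - 1) \in mt_pairs s.

Lemma mem_map_sh n (s : multitilde n) i m x y :
  0 < i -> 0 < m -> 0 < x < y ->
  ((x, y - 1) \in [seq sh i m a | a <- mt_pairs s]) =
  if y <= i then mt_label s x y
  else if (x <= i) && (i + m <= y) then mt_label s x (y - m + 1)
  else (i + m <= x) && mt_label s (x - m + 1) (y - m + 1).
Proof.
move=> hi hm hxy; apply/mapP/idP => [[[a b] hab] | ].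
  have [/= hab1 hab2] := mt_pairsP hab; rewrite /sh /mt_label.
  case: ifP => h1; [|case: ifP => h2] => -[ex ey].
  - rewrite ifT; last by lia.
    by rewrite (_ : (x, _) = (a, b)) //; congr pair; lia.
  - rewrite ifF; last by lia.
    rewrite ifT; last by lia.
    by rewrite (_ : (x, _) = (a, b)) //; congr pair; lia.
  - rewrite ifF; last by lia.
    rewrite ifF; last by lia.
    apply/andP; split; first by lia.
    by rewrite (_ : (x - m + 1, _) = (a, b)) //; congr pair; lia.
rewrite /mt_label; case: ifP => h1; last case: ifP => h2 => [|/andP[h3]] hab.
- by move=> hab; exists (x, y - 1) => //; rewrite /sh ifT //; lia.
- exists (x, y - m + 1 - 1); rewrite // /sh ifF; last by lia.
  by rewrite ifT; [congr pair; lia | lia].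
- exists (x - m + 1, y - m + 1 - 1); rewrite // /sh ifF; last by lia.
  by rewrite ifF; [congr pair; lia | lia].
Qed.

Lemma mem_map_sh0 n (s : multitilde n) i x y : 0 < i -> 0 < x < y ->
  ((x, y - 1) \in [seq sh 0 i a | a <- mt_pairs s]) =
  [&& i <= x, y <= i + n & mt_label s (x - i + 1) (y - i + 1)].
Proof.
move=> hi hxy; apply/mapP/and3P => [[[a b] hab] | [h1 h2 hab]].
  have [/= hab1 hab2] := mt_pairsP hab; rewrite /sh /mt_label.
  case: ifP => h1 [ex ey]; first by lia.
  split; try by lia.
  by rewrite (_ : (_ - _ + 1, _) = (a, b)) //; congr pair; lia.
exists (x - i + 1, y - i + 1 - 1) => //; rewrite /sh.
by case: ifP => h3; [lia | congr pair; lia].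
Qed.

Lemma mt_label_comp n m i (s : multitilde n.+1) (u : multitilde m.+1) x y :
  0 < i <= n.+1 -> 0 < x < y -> y <= (n + m).+2 ->
  mt_label (mt_comp i s u) x y =
  comp_label orb false m.+1 i (mt_label s) (mt_label u) x y.
Proof.
move=> hi hxy hy; rewrite {1}/mt_label.
have [||c ec] := @mt_cell (n + m).+1 x (y - 1); try lia.
rewrite -ec mem_mt_pairs inE ec mem_map_sh // ?mem_map_sh0 //; try lia.
case: comp_labelP => // *; try lia.
- rewrite ifT // (_ : (i <= x) = false) ?orbF //; lia.
- rewrite ifF; last by lia.
  rewrite ifT; last by lia.
  by rewrite (_ : [&& _, _ & _] = false) ?orbF //; lia.
- rewrite ifF; last by lia.
  rewrite ifF; last by lia.
  rewrite (_ : y <= _ = false) ?andbF ?orbF; last by lia.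
  by have -> : i + m.+1 <= x by lia.
- rewrite ifF; last by lia.
  rewrite ifF; last by lia.
  rewrite (_ : i + m.+1 <= x = false) /=; last by lia.
  have -> : i <= x by lia.
  by have -> : y <= i + m.+1 by lia.
- subst x y; rewrite ifF; last by lia.
  rewrite ifT; last by lia.
  rewrite !leqnn /=; congr orb; congr mt_label; lia.
- rewrite ifF; last by lia.
  rewrite ifF; last by lia.
  have -> : i + m.+1 <= x = false by lia.
  by apply/negP => /and3P[]; lia.
Qed.

Lemma dmt_eqP n m (d : dmt n.+1) (e : dmt m.+1) : n = m ->
  (forall x y, 0 < x < y -> y <= n.+2 ->
     mt_label d.1 x y = mt_label e.1 x y /\ mt_label d.2 x y = mt_label e.2 x y) ->
  Tagged (fun n => dmt n.+1) d = Tagged (fun n => dmt n.+1) e.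
Proof.
move=> E; case: _ / E e => e de; congr existT.
have cellE (s u : multitilde n.+1) :
  (forall x y, 0 < x < y -> y <= n.+2 -> mt_label s x y = mt_label u x y) ->
  s = u.
  move=> su; apply/setP => c; rewrite -!mem_mt_pairs.
  have [] := @mt_pairsP _ [set: cell n.+1] (cell_pos c).
    by rewrite mem_mt_pairs inE.
  case: (cell_pos c) => x y /= h1 h2.
  by have := su x y.+1; rewrite /mt_label subn1 /=; apply; lia.
rewrite (surjective_pairing d) (surjective_pairing e).
by congr pair; apply: cellE => x y h1 h2; have [] := de x y h1 h2.
Qed.

Fact dmt_unitl n (d : dmt n.+1) : dmt_comp 1 dmt_unit d = d.
Proof.
apply: (@eq_from_Tagged _ (fun n => dmt n.+1) n).
apply: (@dmt_eqP (0 + n) n) => // x y hxy hy.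
have h0 x' y' : mt_label (set0 : multitilde 1) x' y' = false.
  by apply/imageP => -[c]; rewrite inE.
rewrite !mt_label_comp //; split.
all: case: comp_labelP => // *; try lia.
all: rewrite ?h0 /=; congr (mt_label _ _ _); lia.
Qed.

Fact dmt_unitr n i (d : dmt n.+1) : 0 < i <= n.+1 ->
  Tagged (fun n => dmt n.+1) (dmt_comp i d dmt_unit) =
  Tagged (fun n => dmt n.+1) d.
Proof.
move=> hi; apply: dmt_eqP => [|x y hxy hy]; first by rewrite addn0.
have h0 x' y' : mt_label (set0 : multitilde 1) x' y' = false.
  by apply/imageP => -[c]; rewrite inE.
rewrite !mt_label_comp //; split.
all: case: comp_labelP => // *; try lia.
all: rewrite ?h0 ?orbF; congr (mt_label _ _ _); lia.
Qed.

Lemma mt_label_assoc n m k i j (s : multitilde n.+1) (u : multitilde m.+1)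
    (v : multitilde k.+1) x y :
  0 < i <= n.+1 -> 0 < j <= m.+1 -> 0 < x < y -> y <= (n + m + k).+2 ->
  mt_label (mt_comp (i + j - 1) (mt_comp i s u) v) x y =
  mt_label (mt_comp i s (mt_comp j u v)) x y.
Proof.
move=> hi hj hxy hy; rewrite !mt_label_comp //; try lia.
rewrite (@comp_label_ext _ _ _ (n + m) k _ _
  (comp_label orb false m.+1 i (mt_label s) (mt_label u)) _ (mt_label v)) //;
  try lia; last by move=> *; apply: mt_label_comp.
rewrite (@comp_label_ext _ _ _ n (m + k) _ _ (mt_label s) _
  (comp_label orb false k.+1 j (mt_label u) (mt_label v))) //; try lia; last first.
  by move=> *; apply: mt_label_comp.
by apply: (@comp_label_assoc _ _ _ orbA n).
Qed.

Lemma mt_label_comm n m k i j (s : multitilde n.+1) (u : multitilde m.+1)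
    (v : multitilde k.+1) x y :
  0 < i < j -> j <= n.+1 -> 0 < x < y -> y <= (n + m + k).+2 ->
  mt_label (mt_comp (j + m) (mt_comp i s u) v) x y =
  mt_label (mt_comp i (mt_comp j s v) u) x y.
Proof.
move=> hi hj hxy hy; rewrite !mt_label_comp //; try lia.
rewrite (@comp_label_ext _ _ _ (n + m) k _ _
  (comp_label orb false m.+1 i (mt_label s) (mt_label u)) _ (mt_label v)) //;
  try lia; last by move=> *; apply: mt_label_comp => //; lia.
rewrite (@comp_label_ext _ _ _ (n + k) m _ _
  (comp_label orb false k.+1 j (mt_label s) (mt_label v)) _ (mt_label u)) //;
  try lia; last by move=> *; apply: mt_label_comp => //; lia.
by apply: (@comp_label_comm _ _ _ n).
Qed.

Fact dmt_assoc n m k i j (d : dmt n.+1) (e : dmt m.+1) (f : dmt k.+1) :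
  0 < i <= n.+1 -> 0 < j <= m.+1 ->
  Tagged (fun n => dmt n.+1) (dmt_comp (i + j - 1) (dmt_comp i d e) f) =
  Tagged (fun n => dmt n.+1) (dmt_comp i d (dmt_comp j e f)).
Proof.
move=> hi hj; apply: dmt_eqP => [|x y hxy hy]; first by rewrite addnA.
by split; apply: mt_label_assoc.
Qed.

Fact dmt_commute n m k i j (d : dmt n.+1) (e : dmt m.+1) (f : dmt k.+1) :
  0 < i < j -> j <= n.+1 ->
  Tagged (fun n => dmt n.+1) (dmt_comp (j + m) (dmt_comp i d e) f) =
  Tagged (fun n => dmt n.+1) (dmt_comp i (dmt_comp j d f) e).
Proof.
move=> hi hj; apply: dmt_eqP => [|x y hxy hy]; first by rewrite addnAC.
by split; apply: mt_label_comm.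
Qed.

Definition dmt_set_operad : set_operad :=
  @SetOperad (fun n => dmt n.+1) dmt_unit dmt_comp
    dmt_unitl dmt_unitr dmt_assoc dmt_commute.

Definition DMT (K : fieldType) : operad K := lin_operad K dmt_set_operad.

(** * The suboperad and the map phi *)

Definition dmt_allowed n (d : dmt n.+1) : bool :=
  (n == 0) ==> (d == (set0, set0)).

Definition DMT_sub (K : fieldType) (n : nat) : {pred DMT K n} :=
  fun x => (x : freevs K (dmt n.+1)) \in
    <<[seq basis_vec K d | d in @dmt_allowed n]>>%VS.

Definition phi_label n (d : dmt n) (x y : nat) : D02 :=
  let in_s := (x, y - 1) \in mt_pairs d.1 in
  let in_t := (x, y - 1) \in mt_pairs d.2 in
  if in_s && ~~ in_t then (D0_zero, D0_one)
  else if ~~ in_s && in_t then (D0_one, D0_zero)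
  else if in_s && in_t then (D0_zero, D0_zero)
  else (D0_one, D0_one).

(* In arity 1, only the value at (set0, set0) matters.                        *)
Definition phi_basis n : dmt n.+1 -> clique n.+1 :=
  match n with
  | 0 => fun _ => clique_unit
  | n'.+1 => fun d => mk_clique n'.+2 (phi_label d)
  end.

Definition phi (K : fieldType) (S_subop : is_suboperad (@DMT_sub K)) (n : nat)
    (x : sub_operad S_subop n) : CD02 K n :=
  lin_ext (@phi_basis n) (\val x : freevs K (dmt n.+1)).

(* Main.v *)
Require Import Defs.
From mathcomp Require Import all_boot all_order all_algebra.
From mathcomp Require Import zify.

(** Reading 0 as membership and the unit as non-membership identifies
    D_0 with the monoid ({true, false}, or); so a D_0^2-label is a pair of
    bits saying whether a cell belongs to each of the two multi-tildes, once
    the arc (x, y) is matched with the cell (x, y - 1).  Under this dictionary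
    both partial compositions are instances of the same construction
    [comp_label]: cliques use it with the product of D_0^2 ([label_comp]), and
    multi-tildes with the disjunction ([mt_label_comp]), since a union of two
    sets glues their membership bits by a disjunction.  As [comp_label] is
    natural in the magma of labels ([comp_label_morph]), phi commutes with
    partial compositions on basis elements ([phi_basis_comp]).

    On basis elements phi is a bijection from the double multi-tildes
    satisfying [dmt_allowed]: its inverse [psi_basis] reads the two
    multi-tildes off the labels.  The exclusion of three elements in arity 1
    mirrors the fact that there is only one clique of arity 1.

    Everything is then extended by linearity.  The span of the allowed basis
    elements consists of the vectors whose coordinates vanish on the others
    ([DMT_subP]), so in any sum indexed by a basis only the terms indexed by
    allowed elements contribute, and the statements about basis elements
    suffice. *)

Set Implicit Arguments.
Unset Strict Implicit.
Unset Printing Implicit Defensive.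

Import GRing.Theory.
Local Open Scope ring_scope.

(** * Inverting an isomorphism of operads *)

Lemma is_operad_isomorphism_inv (K : fieldType) (O P : operad K)
    (f : forall n, O n -> P n) (g : forall n, P n -> O n) :
  is_operad_morphism f -> (forall n, cancel (f n) (g n)) ->
  (forall n, cancel (g n) (f n)) -> is_operad_isomorphism g.
Proof.
move=> [f_lin f_unit f_comp] fK gK; split; last by move=> n; exists (f n).
split=> [n a x y | | n m i x y hi].
- by apply: (can_inj (fK n)); rewrite f_lin !gK.
- by rewrite -f_unit fK.
- by apply: (can_inj (fK _)); rewrite f_comp // !gK.
Qed.

(** * Linear extensions *)

Lemma lin_ext_linear (K : fieldType) (T U : finType) (f : T -> U) :
  linear (@lin_ext K T U f).
Proof.
move=> a x y; rewrite /lin_ext scaler_sumr -big_split /=.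
by apply: eq_bigr => t _; rewrite !ffunE scalerDl scalerA.
Qed.

Lemma lin_ext_basis (K : fieldType) (T U : finType) (f : T -> U) (t : T) :
  lin_ext f (basis_vec K t) = basis_vec K (f t).
Proof. exact: sum_basis. Qed.

Lemma lin_ext_comp (K : fieldType) (T U V : finType) (f : T -> U) (g : U -> V)
    (x : freevs K T) : lin_ext g (lin_ext f x) = lin_ext (g \o f) x.
Proof. exact: sum_coord. Qed.

(** The hypothesis is restricted to the support of x so that a bijection
    between parts of two bases gives mutually inverse linear maps. *)
Lemma lin_ext_id (K : fieldType) (T : finType) (f : T -> T) (x : freevs K T) :
  (forall t, x t != 0 -> f t = t) -> lin_ext f x = x.
Proof.
move=> f_id; rewrite [RHS]freevsE; apply: eq_bigr => t _.
by have [-> | /f_id ->] := eqVneq (x t) 0; rewrite ?scale0r.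
Qed.

Lemma span_basis_vecP (K : fieldType) (T : finType) (A : pred T)
    (x : freevs K T) :
  reflect (forall t, ~~ A t -> x t = 0)
    (x \in <<[seq basis_vec K t | t in A]>>%VS).
Proof.
apply: (iffP idP) => [x_span t At | x0].
  rewrite (coord_span (X := in_tuple _) x_span) sum_ffunE big1 // => i _.
  have /imageP[s As e] : (in_tuple [seq basis_vec K t | t in A])`_i
      \in [seq basis_vec K t | t in A] by apply: mem_nth.
  rewrite !ffunE e ffunE (_ : t == s = false) ?scaler0 //.
  by apply/eqP => ts; move: At; rewrite ts => /negP; apply.
rewrite [x]freevsE; apply: memv_suml => t _.
have [At | /x0 ->] := boolP (A t); last by rewrite scale0r mem0v.
by apply/memvZ/memv_span/imageP; exists t.
Qed.

(** * The suboperad of double multi-tildes *)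

Lemma DMT_subP (K : fieldType) (n : nat) (x : DMT K n) :
  reflect (forall d, ~~ dmt_allowed d -> (x : freevs K (dmt n.+1)) d = 0)
    (x \in @DMT_sub K n).
Proof. exact: span_basis_vecP. Qed.

Lemma DMT_sub_support (K : fieldType) (n : nat) (x : DMT K n) (d : dmt n.+1) :
  x \in @DMT_sub K n -> (x : freevs K (dmt n.+1)) d != 0 -> dmt_allowed d.
Proof. by move=> /DMT_subP x0; apply: contraR => /x0 ->. Qed.

(** A composite has arity 1 only when both factors do, and allowed elements
    of arity 1 are equal to the unit. *)
Lemma dmt_allowed_comp n m i (d : dmt n.+1) (e : dmt m.+1) :
  (0 < i <= n.+1)%N -> dmt_allowed d -> dmt_allowed e ->
  dmt_allowed (dmt_comp i d e).
Proof.
case: n m d e => [|n] [|m] d e hi //.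
rewrite /dmt_allowed /= => /eqP -> /eqP ->.
have -> : i = 1%N by lia.
by apply/eqP; apply: (@dmt_unitl 0 (set0, set0)).
Qed.

Lemma DMT_suboperad (K : fieldType) : is_suboperad (@DMT_sub K).
Proof.
split=> [n | | n m i x y hi x_sub y_sub].
- split; first exact: mem0v.
  move=> a u v u_sub v_sub; exact: memvD (memvZ a u_sub) v_sub.
- apply/DMT_subP => d d_bad; rewrite ffunE; case: eqP => // d_unit.
  by case/negP: d_bad; rewrite d_unit; apply/eqP.
- rewrite -[_ \in _]/(lop_comp i x y \in <<_>>%VS).
  apply: memv_suml => d _; apply: memv_suml => e _.
  have [-> | /(DMT_sub_support x_sub) d_ok] := eqVneq (x d) 0.
    by rewrite mul0r scale0r mem0v.
  have [-> | /(DMT_sub_support y_sub) e_ok] := eqVneq (y e) 0.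
    by rewrite mulr0 scale0r mem0v.
  apply/memvZ/memv_span/imageP; exists (dmt_comp i d e) => //.
  exact: dmt_allowed_comp.
Qed.

(** * The bijection between allowed double multi-tildes and cliques *)

Lemma phi_labelE n (d : dmt n) x y :
  phi_label d x y = (~~ mt_label d.1 x y, ~~ mt_label d.2 x y).
Proof. by rewrite /phi_label /mt_label; do 2!case: (_ \in _). Qed.

Lemma label_phi_basis n (d : dmt n.+1) x y :
  dmt_allowed d -> (0 < x < y)%N -> (y <= n.+2)%N ->
  label (phi_basis d) x y = (~~ mt_label d.1 x y, ~~ mt_label d.2 x y).
Proof.
case: n d => [|n] d d_ok hxy hy; last by rewrite label_mk // phi_labelE.
have no_cell : mt_label (set0 : multitilde 1) x y = false.
  by apply/imageP => -[c]; rewrite inE.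
by rewrite label1 (eqP (implyP d_ok _)) // no_cell.
Qed.

Definition psi_basis n (p : clique n.+1) : dmt n.+1 :=
  ([set c | ~~ (label p (cell_pos c).1 (cell_pos c).2.+1).1],
   [set c | ~~ (label p (cell_pos c).1 (cell_pos c).2.+1).2]).

Lemma mt_label_psi_basis n (p : clique n.+1) x y :
  (0 < x < y)%N -> (y <= n.+2)%N ->
  mt_label (psi_basis p).1 x y = ~~ (label p x y).1 /\
  mt_label (psi_basis p).2 x y = ~~ (label p x y).2.
Proof.
move=> hxy hy; have [||c ec] := @mt_cell n.+1 x (y - 1)%N; try lia.
have ey : (y - 1).+1 = y by lia.
by rewrite /mt_label -ec !mem_mt_pairs !inE ec /= ey.
Qed.

Lemma psi_basis_allowed n (p : clique n.+1) : dmt_allowed (psi_basis p).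
Proof.
case: n p => [|n] p //; apply/eqP; rewrite /psi_basis.
by congr pair; apply/setP => c; rewrite !inE label1.
Qed.

Lemma psi_basisK n : cancel (@psi_basis n) (@phi_basis n).
Proof.
move=> p; apply: (@eq_from_Tagged _ (fun n => clique n.+1) n).
apply: clique_eqP => // x y hxy hy.
rewrite label_phi_basis ?psi_basis_allowed //.
have [-> ->] := mt_label_psi_basis p hxy hy.
by rewrite !negbK -surjective_pairing.
Qed.

Lemma phi_basisK n (d : dmt n.+1) :
  dmt_allowed d -> psi_basis (phi_basis d) = d.
Proof.
move=> d_ok; apply: (@eq_from_Tagged _ (fun n => dmt n.+1) n).
apply: dmt_eqP => // x y hxy hy.
have [-> ->] := mt_label_psi_basis (phi_basis d) hxy hy.
by rewrite label_phi_basis //= !negbK.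
Qed.

(** The labels of a composite are copied from p and q, except for the glued
    label, which is a product, and the default label, which is the unit. *)
Lemma comp_label_morph (A B : Type) (star : A -> A -> A) (one : A)
    (star' : B -> B -> B) (one' : B) (h : A -> B) m i
    (p q : nat -> nat -> A) x y :
  {morph h : a b / star a b >-> star' a b} -> h one = one' ->
  h (comp_label star one m i p q x y) =
  comp_label star' one' m i
    (fun x y => h (p x y)) (fun x y => h (q x y)) x y.
Proof.
by move=> h_mul h_one; rewrite /comp_label; do !case: ifP => // _; apply: h_mul.
Qed.

(** Each coordinate of a label is compared separately.  On the left it is the
    negation of a [comp_label] for the disjunction; on the right, a projection
    of a [comp_label] for the product of D_0^2.  Pushing these two morphisms
    inside, by the De Morgan law for the first, gives the same [comp_label] for
    the conjunction. *)
Lemma phi_basis_comp n m i (d : dmt n.+1) (e : dmt m.+1) :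
  (0 < i <= n.+1)%N -> dmt_allowed d -> dmt_allowed e ->
  phi_basis (dmt_comp i d e) = clique_comp i (phi_basis d) (phi_basis e).
Proof.
move=> hi d_ok e_ok.
apply: (@eq_from_Tagged _ (fun n => clique n.+1) (n + m)%N).
apply: clique_eqP => // x y hxy hy.
rewrite label_comp // label_phi_basis ?dmt_allowed_comp //.
rewrite (comp_label_ext _ _ hi hxy hy
  (fun x y => @label_phi_basis n d x y d_ok)
  (fun x y => @label_phi_basis m e x y e_ok)).
rewrite !mt_label_comp // [RHS]surjective_pairing.
congr pair.
- rewrite (comp_label_morph (star' := andb) (one' := true) (h := negb)) //;
    last exact: negb_or.
  by rewrite (comp_label_morph (star' := andb) (one' := true) (h := fst)).
- rewrite (comp_label_morph (star' := andb) (one' := true) (h := negb)) //;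
    last exact: negb_or.
  by rewrite (comp_label_morph (star' := andb) (one' := true) (h := snd)).
Qed.

(** * The isomorphism of operads *)

Section Isomorphism.
Variables (K : fieldType) (S_subop : is_suboperad (@DMT_sub K)).

Lemma phi_morphism : is_operad_morphism (@phi K S_subop).
Proof.
split=> [n a x y | | n m i x y hi].
- rewrite /phi val_subop_lin; exact: lin_ext_linear.
- exact: lin_ext_basis.
- rewrite /phi val_subop_comp_elt //.
  rewrite {1}/lin_ext [op_comp _ _ _]lop_compE sum_coord.
  rewrite [RHS]lop_comp_sum pair_bigA /=.
  apply: eq_bigr => -[d e] _ /=.
  have [-> | /(DMT_sub_support (valP x)) d_ok] := eqVneq (val x d) 0.
    by rewrite mul0r !scale0r.
  have [-> | /(DMT_sub_support (valP y)) e_ok] := eqVneq (val y e) 0.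
    by rewrite mulr0 !scale0r.
  by rewrite phi_basis_comp.
Qed.

Fact psi_subproof n (y : CD02 K n) :
  lin_ext (@psi_basis n) (y : freevs K (clique n.+1)) \in
    subop_pred S_subop (n:=n).
Proof.
apply: memv_suml => p _; apply/memvZ/memv_span/imageP.
by exists (psi_basis p) => //; apply: psi_basis_allowed.
Qed.

Definition psi n (y : CD02 K n) : sub_operad S_subop n :=
  SubopSpace (psi_subproof y).

Lemma phiK n : cancel (@phi K S_subop n) (@psi n).
Proof.
move=> x; apply: val_inj; rewrite /= /phi lin_ext_comp.
by apply: lin_ext_id => d /(DMT_sub_support (valP x)); apply: phi_basisK.
Qed.

Lemma psiK n : cancel (@psi n) (@phi K S_subop n).
Proof.
move=> y; rewrite /phi /= lin_ext_comp.
by apply: lin_ext_id => p _; apply: psi_basisK.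
Qed.

End Isomorphism.

Theorem proposition5p3p2 (K : fieldType) (charK : [pchar K] =i pred0) :
  exists S_subop : is_suboperad (@DMT_sub K),
    operad_isomorphic (CD02 K) (sub_operad S_subop) /\
    is_operad_isomorphism (@phi K S_subop).
Proof.
exists (DMT_suboperad K); split.
  exists (@psi K (DMT_suboperad K)).
  apply: is_operad_isomorphism_inv (@phi_morphism K _) _ _.
    exact: phiK.
  exact: psiK.
split; first exact: phi_morphism.
by move=> n; exists (@psi K (DMT_suboperad K) n); [apply: phiK | apply: psiK].
Qed.
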